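(* Let $n\ge2$, $t=n(n-1)/2$, and let $G$ be any subgroup of finite index in $\mathrm{SL}_n(\mathbb{Z})$. Let $D$ be a torsionfree normal subgroup of $G$ of finite index, let $z_D\in Sh_t\otimes_D\mathbb{Q}$ be a sharbly cycle for $D$ constructed as in the context, and let $z_G=[G:D]^{-1}\iota(z_D)\in Sh_t\otimes_G\mathbb{Q}$. Then $\partial z_G=0$.
   Context: **Sharbly complex.** Put $d=n(n+1)/2=n+t$. For $k\ge0$, $Sh_k$ is the $\mathbb{Q}$-vector space generated by symbols $[v_1,\dots,v_{n+k}]$ (called basic sharblies), with $v_i$ nonzero column vectors in $\mathbb{Q}^n$, modulo the relations: (i) $[v_{\sigma(1)},\dots,v_{\sigma(n+k)}]=\mathrm{sign}(\sigma)[v_1,\dots,v_{n+k}]$ for all permutations $\sigma$; (ii) $[v_1,\dots,v_{n+k}]=0$ if the $v_i$ do not span $\mathbb{Q}^n$; (iii) $[v_1,v_2,\dots,v_{n+k}]=[av_1,v_2,\dots,v_{n+k}]$ for all $a\in\mathbb{Q}^\times$. The group $\mathrm{GL}_n(\mathbb{Q})$ acts by $g[v_1,\dots,v_{n+k}]=[gv_1,\dots,gv_{n+k}]$. The boundary $\partial:Sh_k\to Sh_{k-1}$ is $\partial[v_1,\dots,v_{n+k}]=\sum_{i}(-1)^{i+1}[v_1,\dots,\widehat{v_i},\dots,v_{n+k}]$. For a subgroup $\Gamma$ of $\mathrm{SL}_n(\mathbb{Z})$, $Sh_k\otimes_\Gamma\mathbb{Q}$ denotes the $\Gamma$-coinvariants,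 $[v_1,\dots,v_{n+k}]_\Gamma$ the image of $[v_1,\dots,v_{n+k}]$ in them, and $\partial$ also denotes the induced boundary map. **Voronoi cones.** $Y$ is the space of real symmetric $n\times n$ matrices (dimension $d$) with a fixed orientation, and $C\subset Y$ the open cone of positive definite matrices, with the compatible orientation. $C^*$ is the union of $C$ with all positive semidefinite symmetric matrices whose kernel is $W\otimes\mathbb{R}$ for some nonzero subspace $W\subset\mathbb{Q}^n$. The group $\mathrm{SL}_n(\mathbb{Z})$ acts on $C^*$ by $\gamma\cdot x=\gamma x\,{}^t\gamma$. For a nonzero column vector $v\in\mathbb{Q}^n$ put $v'=v\,{}^tv\in C^*$. Let $s(v_1,\dots,v_m)$ be the closed convex conical hull of $v_1',\dots,v_m'$; when the $v_i'$ span distinct extremal rays of it they are called its vertices (defined up to positive scalars). A positive definite real quadratic form $Q$ whose minimal nonzero integral vectors are exactly $\pm v_1,\dots,\pm v_m$ is perfect if $v_1',\dots,v_m'$ span $Y$; then $s_Q=s(v_1,\dots,v_m)$ is a $d$-dimensional cone. A tile is such a cone $s_Q$ ($Q$ perfect), oriented by the orientation of $Y$. Tiles are permuted by $\mathrm{SL}_n(\mathbb{Z})$, with finitely many orbits. **Triangulations.** A triangulation of a tile $T$ is a decomposition of $T$ into $d$-dimensional simplicial cones whose vertices are among those of $T$, any two of which meet in a common face. Let $H\subset Y$ be an affine hyperplane meeting each ray of $C^*\setminus\{0\}$ in exactly one point (e.g. trace $=1$). The triangulation is regular if its intersection with $H$ is a regular (coherent) triangulation of the polytope $T\cap H$, i.e.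 there is a continuous convex function on $T\cap H$ that is piecewise affine and whose maximal domains of affineness are exactly the maximal simplices. **Sharbly of a cone; flipons.** For a $d$-dimensional simplicial cone $s$ in $C^*$ with vertices $v_1',\dots,v_d'$ ($v_i\in\mathbb{Q}^n$), $[s]=[v_1,\dots,v_d]\in Sh_t$, where the $v_i$ are listed in an order inducing on $s$ the orientation compatible with that of $Y$. A flipon is a basic $t$-sharbly $[v_1,\dots,v_d]$ such that some affine subspace of $Y$ of dimension $d-2$ contains $v_i'$ for all $i$. **The cycle $z_D$ ($D$ torsionfree).** Choose a set $R_D$ of representatives of the $D$-orbits of tiles and a regular triangulation of each $T\in R_D$; let $\mathcal{S}$ be the set of all resulting $d$-dimensional simplicial cones. Then $z_D=\sum_{s\in\mathcal{S}}[s]_D+\sum_\alpha[y_1^\alpha,\dots,y_d^\alpha]_D$, where $[y_1^\alpha,\dots,y_d^\alpha]$ are finitely many flipons chosen so that $\partial z_D=0$ (such flipons exist). **The map $\iota$.** $\iota:Sh_k\otimes_D\mathbb{Q}\to Sh_k\otimes_G\mathbb{Q}$ is the natural (well-defined) linear map with $\iota([v_1,\dots,v_{n+k}]_D)=[v_1,\dots,v_{n+k}]_G$. *)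

(* Defs.v *)
From HB Require Import structures.
From mathcomp Require Import all_boot all_order all_algebra perm finmap interval_inference.
From mathcomp Require Import all_classical all_reals.
From mathcomp Require Import topology normedtype convex.
(* The notations of monalg clash with those of MathComp-Analysis. *)
From mathcomp Require Import -(notations) monalg.

Set Implicit Arguments.
Unset Strict Implicit.
Unset Printing Implicit Defensive.

Import Order.TTheory GRing.Theory Num.Theory.
Import numFieldNormedType.Exports.

Local Open Scope classical_set_scope.
Local Open Scope convex_scope.
Local Open Scope ring_scope.
Local Open Scope quotient_scope.

Definition lin_span (K : nzRingType) (V : lmodType K) (S : set V) : set V :=
  smallest [set P | submod_closed [in P]] S.

Definition lin_spanb (K : nzRingType) (V : lmodType K) (S : set V) : {pred V} :=
  fun x => x \in lin_span S.

Section LinSpan.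
Context (K : nzRingType) (V : lmodType K) (S : set V).

Lemma sub_lin_span : S `<=` lin_span S.
Proof. exact: sub_smallest. Qed.

Lemma lin_span_min (P : set V) :
  submod_closed [in P] -> S `<=` P -> lin_span S `<=` P.
Proof. by move=> hP SP; apply: smallest_sub. Qed.

Lemma lin_span_closed : submod_closed [in lin_span S].
Proof.
split=> [|a x y]; rewrite !inE.
  by move=> P [[P0 _] _]; move: P0; rewrite inE.
move=> hx hy P [hP SP]; have := hP.2 a x y; rewrite !inE; apply.
- by apply: hx.
- by apply: hy.
Qed.

Lemma lin_spanb_zmod : zmod_closed (lin_spanb S).
Proof. exact: GRing.submod_closedB lin_span_closed. Qed.

HB.instance Definition _ := GRing.isZmodClosed.Build V (lin_spanb S) lin_spanb_zmod.

(* The quotient of V by the submodule generated by S. *)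
Definition lquot := Quotient.quot (lin_spanb S).

HB.instance Definition _ := GRing.Zmodule.on lquot.

Definition lproj : V -> lquot := \pi_(Quotient.quot (lin_spanb S)).

Definition lquot_scale (a : K) (x : lquot) : lquot := lproj (a *: repr x).

Lemma lproj_eq x y : (lproj x = lproj y) <-> lin_span S (x - y).
Proof.
rewrite /lproj; split=> [/eqP|h]; last apply/eqP; rewrite -Quotient.idealrBE.
  by rewrite unfold_in /lin_spanb inE.
by rewrite unfold_in /lin_spanb inE.
Qed.

Lemma lprojZ a x : lquot_scale a (lproj x) = lproj (a *: x).
Proof.
apply/lproj_eq; rewrite -scalerBr.
have := lin_span_closed.2 a (repr (lproj x) - x) 0; rewrite !inE addr0; apply.
  by apply/lproj_eq; exact: reprK.
by have := lin_span_closed.1; rewrite inE.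
Qed.

Lemma lprojP (x : lquot) : lproj (repr x) = x.
Proof. exact: reprK. Qed.

Lemma lproj_zmod : zmod_morphism lproj.
Proof. exact: raddfB. Qed.

HB.instance Definition _ := GRing.isZmodMorphism.Build V lquot lproj lproj_zmod.

Fact lquot_scaleA a b x : lquot_scale a (lquot_scale b x) = lquot_scale (a * b) x.
Proof. by rewrite -(lprojP x) !lprojZ scalerA. Qed.

Fact lquot_scale1 : left_id 1 lquot_scale.
Proof. by move=> x; rewrite -(lprojP x) lprojZ scale1r. Qed.

Fact lquot_scaleDr : right_distributive lquot_scale +%R.
Proof.
move=> a x y; rewrite -(lprojP x) -(lprojP y) -raddfD !lprojZ -raddfD.
by rewrite scalerDr.
Qed.

Fact lquot_scaleDl x : {morph lquot_scale^~ x : a b / a + b}.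
Proof. by move=> a b; rewrite -(lprojP x) !lprojZ -raddfD scalerDl. Qed.

HB.instance Definition _ := GRing.Zmodule_isLmodule.Build K lquot
  lquot_scaleA lquot_scale1 lquot_scaleDr lquot_scaleDl.

Fact lproj_scalable : scalable lproj.
Proof. by move=> a x; rewrite -lprojZ. Qed.

HB.instance Definition _ := GRing.isScalable.Build K V lquot *:%R lproj
  lproj_scalable.

End LinSpan.

(* The map induced by f on quotients; lmapE is its characteristic property. *)
Definition lmap (K : nzRingType) (V W : lmodType K) (S : set V) (T : set W)
  (f : V -> W) (x : lquot S) : lquot T := lproj T (f (repr x)).

Section LMap.
Context (K : nzRingType) (V W : lmodType K) (S : set V) (T : set W).
Context (f : {linear V -> W}) (fST : forall x, S x -> lin_span T (f x)).

Lemma lmapE x : lmap T f (lproj S x) = lproj T (f x).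
Proof.
apply/lproj_eq; rewrite -linearB.
have : lin_span S (repr (lproj S x) - x) by apply/lproj_eq; exact: lprojP.
apply: (@lin_span_min _ _ _ [set y | lin_span T (f y)]) => //.
have [c0 cL] := lin_span_closed T.
split=> [|a y z]; rewrite !inE /=; first by rewrite linear0; rewrite inE in c0.
by move=> fy fz; rewrite linearP; have := cL a (f y) (f z); rewrite !inE; apply.
Qed.

Lemma lmap_linear : linear (lmap T f : lquot S -> lquot T).
Proof.
move=> a x y; rewrite -(lprojP x) -(lprojP y) -linearP !lmapE.
by rewrite !linearP.
Qed.
End LMap.

(* The linear map on the free module with basis T that extends f : T -> V. *)
Definition free_ext (K : nzRingType) (T : choiceType) (V : lmodType K)
  (f : T -> V) (x : malg T K) : V :=
  \sum_(k <- msupp x) mcoeff k x *: f k.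

Section FreeExt.
Context (K : nzRingType) (T : choiceType) (V : lmodType K) (f : T -> V).

Lemma free_extw (x : malg T K) (d : {fset T}) : (msupp x `<=` d)%fset ->
  free_ext f x = \sum_(k <- d) mcoeff k x *: f k.
Proof.
move=> le_xd; rewrite /free_ext -(big_fset_incl _ le_xd) //= => k _ kx.
by rewrite mcoeff_outdom // scale0r.
Qed.

Lemma free_ext_linear : linear (free_ext f).
Proof.
move=> a x y; pose d := (msupp x `|` msupp y `|` msupp (a *: x + y))%fset.
have dx : (msupp x `<=` d)%fset.
  by apply/fsubsetP => k kx; rewrite !in_fsetU kx.
have dy : (msupp y `<=` d)%fset.
  by apply/fsubsetP => k kx; rewrite !in_fsetU kx orbT.
rewrite (free_extw dx) (free_extw dy) (@free_extw _ d) ?fsubsetUr//.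
rewrite scaler_sumr -big_split /=; apply: eq_bigr => k _.
by rewrite mcoeffD mcoeffZ scalerDl scalerA.
Qed.

HB.instance Definition _ := GRing.isLinear.Build K (malg T K) V *:%R
  (free_ext f) free_ext_linear.

Lemma free_extU k : free_ext f (mkmalgU k 1) = f k.
Proof.
rewrite (@free_extw _ [fset k]%fset) ?msuppU_le//.
by rewrite big_seq_fset1 mcoeffUU scale1r.
Qed.

End FreeExt.

Definition SL (n : nat) := {A : 'M[int]_n | \det A == 1}.
HB.instance Definition _ n := Choice.on (SL n).

Section SLGroup.
Variable n : nat.
Implicit Types A B C : SL n.

Fact SL_one_subproof : \det (1%:M : 'M[int]_n) == 1.
Proof. by rewrite det1. Qed.
Definition SL_one : SL n := exist _ 1%:M SL_one_subproof.

Fact SL_mul_subproof A B : \det (val A *m val B) == 1.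
Proof. by rewrite det_mulmx (eqP (valP A)) (eqP (valP B)) mulr1. Qed.
Definition SL_mul A B : SL n := exist _ (val A *m val B) (SL_mul_subproof A B).

Fact SL_inv_subproof A : \det (\adj (val A)) == 1.
Proof.
have := congr1 determinant (mul_mx_adj (val A)).
by rewrite det_mulmx (eqP (valP A)) mul1r det1 => ->.
Qed.
Definition SL_inv A : SL n := exist _ (\adj (val A)) (SL_inv_subproof A).

Fact SL_mulA : associative SL_mul.
Proof. by move=> A B C; apply: val_inj; rewrite /= mulmxA. Qed.
Fact SL_mul1 : left_id SL_one SL_mul.
Proof. by move=> A; apply: val_inj; rewrite /= mul1mx. Qed.
Fact SL_mulr1 : right_id SL_one SL_mul.
Proof. by move=> A; apply: val_inj; rewrite /= mulmx1. Qed.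
Fact SL_mulV : left_inverse SL_one SL_inv SL_mul.
Proof.
by move=> A; apply: val_inj; rewrite /= mul_adj_mx (eqP (valP A)).
Qed.
Fact SL_mulrV : right_inverse SL_one SL_inv SL_mul.
Proof.
by move=> A; apply: val_inj; rewrite /= mul_mx_adj (eqP (valP A)).
Qed.

HB.instance Definition _ := isGroup.Build (SL n)
  SL_mulA SL_mul1 SL_mulr1 SL_mulV SL_mulrV.
End SLGroup.

Definition GLQ (n : nat) := {g : 'M[rat]_n | g \in unitmx}.

Fact GLQ_of_SL_subproof n (A : SL n) : map_mx intr (val A) \in @unitmx rat n.
Proof. by rewrite unitmxE det_map_mx (eqP (valP A)) rmorph1 unitr1. Qed.

Definition GLQ_of_SL n (A : SL n) : GLQ n :=
  exist _ (map_mx intr (val A)) (GLQ_of_SL_subproof A).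

Definition cosets (gT : groupType) (G D : set gT) : set (set gT) :=
  [set [set (g * h)%g | h in D] | g in G].

Definition finite_index (gT : groupType) (G D : set gT) :=
  finite_set (cosets G D).

(* [G : D], meaningful when it is finite *)
Definition group_index (gT : groupType) (G D : set gT) : nat :=
  #|` fset_set (cosets G D)|%fset.

Definition normal_in (gT : groupType) (G D : set gT) :=
  D `<=` G /\ forall g h, G g -> D h -> D (h ^ g)%g.

Definition torsionfree (gT : groupType) (D : set gT) :=
  forall g k, D g -> (0 < k)%N -> (g ^+ k = 1)%g -> g = 1%g.

Definition nzvec (n : nat) := {v : 'cV[rat]_n | v != 0}.

Definition symbol (n m : nat) := {ffun 'I_m -> nzvec n}.

Definition free_sharbly (n m : nat) : lmodType rat := malg (symbol n m) rat.

Definition free_basic n m (v : symbol n m) : free_sharbly n m := mkmalgU v 1.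

Variant sharbly_rel (n m : nat) : set (free_sharbly n m) :=
| SharblyPerm (v : symbol n m) (s : 'S_m) :
    sharbly_rel (free_basic [ffun i => v (s i)] - (-1) ^+ s *: free_basic v)
| SharblySpan (v : symbol n m) :
    <<codom (fun i => val (v i))>>%VS <> fullv ->
    sharbly_rel (free_basic v)
| SharblyScale (v w : symbol n m) (a : rat) :
    a != 0 ->
    (forall i : 'I_m, val (w i) =
       if (i == 0 :> nat)%N then a *: val (v i) else val (v i)) ->
    sharbly_rel (free_basic v - free_basic w).

(* Sharblies are indexed by the number m of vectors: Sh_k is sharbly n (n + k).
   Nothing spans Q^n when m < n, so that sharbly n m is then zero, as Sh_{-1}. *)
Definition sharbly (n m : nat) : lmodType rat := lquot (@sharbly_rel n m).

Definition basic n m (v : symbol n m) : sharbly n m :=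
  lproj (@sharbly_rel n m) (free_basic v).

Fact GLQ_nz n (g : GLQ n) (v : nzvec n) : val g *m val v != 0.
Proof.
apply: contraNneq (valP v) => gv0.
by rewrite -(mulKmx (valP g) (val v)) gv0 mulmx0.
Qed.

Definition act_nz n (g : GLQ n) (v : nzvec n) : nzvec n :=
  exist _ (val g *m val v) (GLQ_nz g v).

Definition act_symbol n m (g : GLQ n) (v : symbol n m) : symbol n m :=
  [ffun i => act_nz g (v i)].

Definition free_act n m (g : GLQ n) : free_sharbly n m -> free_sharbly n m :=
  free_ext (fun v => free_basic (act_symbol g v)).

Definition act n m (g : GLQ n) : sharbly n m -> sharbly n m :=
  lmap (@sharbly_rel n m) (@free_act n m g).

(* Omits the vector with index i; the sign (-1)^i below counts from 0. *)
Definition face n m (v : symbol n m) (i : 'I_m) : symbol n m.-1 :=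
  [ffun j => v (lift i j)].

Definition free_bound n m : free_sharbly n m -> free_sharbly n m.-1 :=
  free_ext (fun v => \sum_(i < m) (-1) ^+ i *: free_basic (face v i)).

Definition bound n m : sharbly n m -> sharbly n m.-1 :=
  lmap (@sharbly_rel n m.-1) (@free_bound n m).

Definition coinv_rel n m (G : set (SL n)) : set (sharbly n m) :=
  [set y | exists2 g, G g & exists x, y = act (GLQ_of_SL g) x - x].

(* The coinvariants of sharbly n m under G. *)
Definition coinv n m (G : set (SL n)) : lmodType rat := lquot (@coinv_rel n m G).

Definition coproj n m (G : set (SL n)) : sharbly n m -> coinv m G :=
  lproj (@coinv_rel n m G).

Definition cobound n m (G : set (SL n)) : coinv m G -> coinv m.-1 G :=
  lmap (@coinv_rel n m.-1 G) (@bound n m).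

Definition iota_map n m (D G : set (SL n)) : coinv m D -> coinv m G :=
  lmap (@coinv_rel n m G) (fun x : sharbly n m => x).

Lemma sharbly_ind n m (P : sharbly n m -> Prop) :
  P 0 -> (forall a x y, P x -> P y -> P (a *: x + y)) ->
  (forall v, P (basic v)) -> forall x, P x.
Proof.
move=> P0 PL Pb x; rewrite -(lprojP x) (monalgE (repr x)) raddf_sum.
elim/big_rec: _ => [|v y _ Py]; first exact: P0.
suff -> : mkmalgU v (mcoeff v (repr x)) = mcoeff v (repr x) *: free_basic v.
  by rewrite /= linearZ; apply: PL => //; exact: Pb.
by apply/malgP => k; rewrite mcoeffZ !mcoeffU mulr_natr.
Qed.

Lemma spanning_act n m (g : GLQ n) (v : symbol n m) :
  <<codom (fun i => val (act_symbol g v i))>>%VS = fullv ->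
  <<codom (fun i => val (v i))>>%VS = fullv.
Proof.
move=> h; apply/eqP; rewrite eqEdim subvf /= -h.
pose f := linfun (mulmx (val g) : 'cV[rat]_n -> 'cV[rat]_n).
have -> : codom (fun i => val (act_symbol g v i)) =
          map f (codom (fun i => val (v i))).
  by rewrite /codom -map_comp; apply: eq_map => i; rewrite /= lfunE /= ffunE.
by rewrite -limg_span -(limg_ker_dim f <<_>>) leq_addl.
Qed.

Lemma spanning_face n m (v : symbol n m) i :
  <<codom (fun j => val (face v i j))>>%VS = fullv ->
  <<codom (fun j => val (v j))>>%VS = fullv.
Proof.
move=> h; apply/eqP; rewrite eqEsubv subvf -h; apply: sub_span.
move=> _ /codomP[j ->]; rewrite ffunE; exact: codom_f.
Qed.

Lemma free_actU n m (g : GLQ n) (v : symbol n m) :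
  free_act g (free_basic v) = free_basic (act_symbol g v).
Proof. exact: free_extU. Qed.

Lemma free_boundU n m (v : symbol n m) :
  free_bound (free_basic v) = \sum_(i < m) (-1) ^+ i *: free_basic (face v i).
Proof. exact: free_extU. Qed.

HB.instance Definition _ n m g := GRing.Linear.on (@free_act n m g).
HB.instance Definition _ n m := GRing.Linear.on (@free_bound n m).

Lemma sharbly_rel_act n m (g : GLQ n) x :
  @sharbly_rel n m x -> lin_span (@sharbly_rel n m) (free_act g x).
Proof.
case=> [v s|v nv|v w a a0 vw].
- rewrite linearB linearZ /= !free_actU.
  rewrite (_ : act_symbol g _ = [ffun i => act_symbol g v (s i)]).
    by apply: sub_lin_span; exact: SharblyPerm.
  by apply/ffunP => i; rewrite !ffunE.
- rewrite free_actU; apply: sub_lin_span; apply: SharblySpan.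
  by move/spanning_act.
- rewrite linearB /= !free_actU; apply: sub_lin_span.
  apply: (SharblyScale a0) => i; rewrite !ffunE /= vw.
  by case: ifP => // _; rewrite scalemxAr.
Qed.

Lemma lift_perm_surj n (s : 'S_n.+1) (i : 'I_n.+1) :
  exists t : 'S_n, s = lift_perm i (s i) t.
Proof.
pose f (k : 'I_n) : 'I_n := odflt k (unlift (s i) (s (lift i k))).
have fE k : s (lift i k) = lift (s i) (f k).
  rewrite /f; case: unliftP => [j ->//|/perm_inj/eqP].
  by rewrite eq_sym (negbTE (neq_lift _ _)).
have finj : injective f.
  move=> k l /(congr1 (lift (s i))); rewrite -!fE => /perm_inj.
  exact: lift_inj.
exists (perm finj); apply/permP => k.
case: (unliftP i k) => [j ->|->]; last by rewrite lift_perm_id.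
by rewrite lift_perm_lift permE fE.
Qed.

Lemma sharbly_rel_bound_ker n m (W : lmodType rat)
    (p : {linear free_sharbly n m.-1 -> W}) :
  (forall y, sharbly_rel y -> p y = 0) ->
  forall x : free_sharbly n m, sharbly_rel x -> p (free_bound x) = 0.
Proof.
move=> p0.
have pb v : p (free_bound (free_basic v)) =
            \sum_(i < m) (-1) ^+ i *: p (free_basic (face v i)).
  by rewrite free_boundU linear_sum; apply: eq_bigr => i _; rewrite linearZ.
have pB x y : p (free_bound (x - y)) = p (free_bound x) - p (free_bound y).
  by rewrite linearB /= linearB.
have pZ a x : p (free_bound (a *: x)) = a *: p (free_bound x).
  by rewrite linearZ /= linearZ.
move=> _ [v s|v nv|v w a a0 vw].
- apply/eqP; rewrite pB pZ [X in X - _]pb [X in _ *: X]pb subr_eq0; apply/eqP.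
  rewrite scaler_sumr [RHS](reindex_inj (@perm_inj _ s)) /=.
  apply: eq_bigr => i _; rewrite scalerA {pb pB pZ}.
  case: m p p0 v s i => [|m] p p0 v s i; first by case: i.
  have [t st] := lift_perm_surj s i.
  have /eqP := p0 _ (SharblyPerm (face v (s i)) t).
  rewrite linearB linearZ subr_eq0 /= => /eqP.
  set u := free_basic _; rewrite (_ : u = free_basic (face [ffun j => v (s j)] i)).
    move=> ->; rewrite scalerA; congr (_ *: _).
    have -> : odd_perm s = odd i (+) odd (s i) (+) t.
      by rewrite {1}st odd_lift_perm.
    rewrite -(signr_odd rat i) -(signr_odd rat (s i)) -!signr_addb.
    congr (_ ^+ nat_of_bool _).
    by case: (odd i); case: (odd (s i)); case: (odd_perm t).
  rewrite /u; congr free_basic; apply/ffunP => k.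
  by rewrite !ffunE {2}st lift_perm_lift.
- rewrite pb big1 // => i _; rewrite p0 ?scaler0//.
  by apply: SharblySpan => /spanning_face.
- rewrite pB [X in X - _]pb [X in _ - X]pb -sumrB big1 // => i _; rewrite -scalerBr.
  have [i0|i0] := eqVneq (i : nat) 0%N.
    rewrite (_ : face w i = face v i) ?subrr ?scaler0//.
    by apply/ffunP => j; apply: val_inj; rewrite !ffunE vw /= /bump i0.
  rewrite -linearB p0 ?scaler0//; apply: (SharblyScale a0) => j.
  rewrite !ffunE vw /= /bump; case: (nat_of_ord i) i0 => // k _.
  by case: (nat_of_ord j) => [//|l]; rewrite addnS.
Qed.

Lemma sharbly_rel_bound n m x :
  @sharbly_rel n m x -> lin_span (@sharbly_rel n m.-1) (free_bound x).
Proof.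
move=> hx; rewrite -[free_bound x]subr0; apply/lproj_eq; rewrite raddf0.
apply: sharbly_rel_bound_ker hx => y hy.
rewrite -(raddf0 (lproj (@sharbly_rel n m.-1))); apply/lproj_eq.
by rewrite subr0; exact: sub_lin_span.
Qed.

Lemma actE n m (g : GLQ n) (v : symbol n m) :
  act g (basic v) = basic (act_symbol g v).
Proof.
rewrite /act /basic (lmapE (f := @free_act n m g) (@sharbly_rel_act n m g)).
by rewrite /= free_actU.
Qed.

Fact act_linear n m (g : GLQ n) : linear (@act n m g).
Proof. exact: (lmap_linear (f := @free_act n m g) (@sharbly_rel_act n m g)). Qed.

HB.instance Definition _ n m (g : GLQ n) :=
  GRing.isLinear.Build rat (sharbly n m) (sharbly n m) *:%R (act g) (act_linear g).

Lemma boundE n m (v : symbol n m) :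
  bound (basic v) = \sum_(i < m) (-1) ^+ i *: basic (face v i).
Proof.
rewrite /bound /basic (lmapE (f := @free_bound n m) (@sharbly_rel_bound n m)).
by rewrite /= free_boundU linear_sum; apply: eq_bigr => i _; rewrite linearZ.
Qed.

Fact bound_linear n m : linear (@bound n m).
Proof. exact: (lmap_linear (f := @free_bound n m) (@sharbly_rel_bound n m)). Qed.

HB.instance Definition _ n m :=
  GRing.isLinear.Build rat (sharbly n m) (sharbly n m.-1) *:%R (@bound n m)
    (@bound_linear n m).

Lemma bound_act n m (g : GLQ n) (x : sharbly n m) :
  bound (act g x) = act g (bound x).
Proof.
elim/sharbly_ind: x => [|a x y hx hy|v]; first by rewrite !linear0.
  by rewrite !linearP /= hx hy.
rewrite actE !boundE linear_sum; apply: eq_bigr => i _.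
rewrite linearZ /= actE; congr (_ *: basic _).
by apply/ffunP => j; rewrite !ffunE.
Qed.

Lemma coinv_rel_bound n m (G : set (SL n)) (x : sharbly n m) :
  coinv_rel G x -> lin_span (coinv_rel G) (bound x).
Proof.
move=> [g Gg [y ->]]; apply: sub_lin_span; exists g => //; exists (bound y).
by rewrite linearB /= bound_act.
Qed.

Lemma coboundE n m (G : set (SL n)) (x : sharbly n m) :
  cobound (coproj G x) = coproj G (bound x).
Proof. exact: (lmapE (f := @bound n m) (@coinv_rel_bound n m G)). Qed.

Fact cobound_linear n m (G : set (SL n)) :
  linear (@cobound n m G).
Proof. exact: (lmap_linear (f := @bound n m) (@coinv_rel_bound n m G)). Qed.

HB.instance Definition _ n m (G : set (SL n)) :=
  GRing.isLinear.Build rat (coinv m G) (coinv m.-1 G) *:%R (@cobound n m G)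
    (@cobound_linear n m G).

Lemma iota_mapE n m (D G : set (SL n)) (x : sharbly n m) :
  D `<=` G -> iota_map G (coproj D x) = coproj G x.
Proof.
move=> DG; apply: (lmapE (f := idfun)) => y [g Dg hy].
by apply: sub_lin_span; exists g => //; exact: DG.
Qed.

Lemma iota_map_linear n m (D G : set (SL n)) :
  D `<=` G -> linear (iota_map G : coinv m D -> coinv m G).
Proof.
move=> DG; apply: (lmap_linear (f := idfun)) => y [g Dg hy].
by apply: sub_lin_span; exists g => //; exact: DG.
Qed.

(* t and d *)
Definition tnum (n : nat) : nat := (n * n.-1)./2.
Definition dnum (n : nat) : nat := n + tnum n.

Lemma dnumE n : dnum n = (n * n.+1)./2.
Proof.
rewrite /dnum /tnum; have := halfD n.*2 (n * n.-1).
rewrite odd_double doubleK add0n => <-; congr half.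
by case: n => [//|n]; rewrite -muln2 -mulnDr.
Qed.

Section Voronoi.
Context (R : realType) (n : nat).
Implicit Types (A B Q : 'M[R]_n) (S F C T H : set 'M[R]_n).

Definition symY : {vspace 'M[R]_n} := lker (linfun trmx - \1)%VF.

Lemma mem_symY A : (A \in symY) = (A^T == A).
Proof.
by rewrite memv_ker add_lfunE opp_lfunE id_lfunE lfunE /= subr_eq0.
Qed.

Definition affine_subspace (k : nat) (E : set 'M[R]_n) :=
  exists (p : 'M[R]_n) (U : {vspace 'M[R]_n}),
    [/\ p \in symY, (U <= symY)%VS, \dim U = k & E = [set A | A - p \in U]].

Definition qform Q (x : 'cV[R]_n) : R := (x^T *m Q *m x) 0 0.

Definition posdef Q := Q \in symY /\ forall x, x != 0 -> 0 < qform Q x.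

Definition possemidef Q := Q \in symY /\ forall x, 0 <= qform Q x.

Definition Cstar : set 'M[R]_n := [set A | posdef A \/
  (possemidef A /\ exists W : {vspace 'cV[rat]_n}, W <> 0%VS /\
    forall x : 'cV[R]_n,
      A *m x = 0 <-> x \in <<[seq map_mx ratr w | w <- vbasis W]>>%VS)].

Definition SL_act (g : SL n) A : 'M[R]_n :=
  map_mx intr (val g) *m A *m (map_mx intr (val g))^T.

(* v' = v v^T *)
Definition sq (v : 'cV[rat]_n) : 'M[R]_n := map_mx ratr (v *m v^T).

Definition sqZ (v : 'cV[int]_n) : 'M[R]_n := sq (map_mx intr v).

Definition convex_cone C :=
  [/\ C 0, forall A B, C A -> C B -> C (A + B) &
      forall (a : R) A, 0 <= a -> C A -> C (a *: A)].

Definition cone_hull S : set 'M[R]_n :=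
  smallest [set C | closed C /\ convex_cone C] S.

(* Faces of a convex cone, in the sense of extreme subcones. *)
Definition is_face F C :=
  [/\ convex_cone F, F `<=` C &
      forall A B, C A -> C B -> F (A + B) -> F A /\ F B].

Definition ray A : set 'M[R]_n := [set a *: A | a in [set a : R | 0 <= a]].

(* A spans an extremal ray of C *)
Definition is_vertex A C := A <> 0 /\ is_face (ray A) C.

Definition min_vector Q (v : 'cV[int]_n) :=
  v <> 0 /\ forall u : 'cV[int]_n, u <> 0 ->
    qform Q (map_mx intr v) <= qform Q (map_mx intr u).

Definition tile T := exists Q (vs : seq 'cV[int]_n),
  [/\ posdef Q,
      forall v, min_vector Q v <-> (v \in vs) || (- v \in vs),
      <<[seq sqZ v | v <- vs]>>%VS = symY &
      T = cone_hull [set sqZ v | v in [set` vs]]].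

(* s is the d-dimensional simplicial cone with vertices v_1', ..., v_d' *)
Definition simplicial_cone (s : set 'M[R]_n) (v : symbol n (dnum n)) :=
  free (codom (fun i => sq (val (v i)))) /\
  s = cone_hull (range (fun i => sq (val (v i)))).

Definition triangulation T (K : set (set 'M[R]_n)) :=
  [/\ finite_set K,
      forall s, K s -> exists2 v : symbol n (dnum n),
        simplicial_cone s v & forall i, is_vertex (sq (val (v i))) T,
      T = \bigcup_(s in K) s &
      forall s1 s2, K s1 -> K s2 ->
        is_face (s1 `&` s2) s1 /\ is_face (s1 `&` s2) s2].

(* Domains of affineness are convex subsets. *)
Definition affine_domain (P : set 'M[R]_n) (f : 'M[R]_n -> R) (E : set 'M[R]_n) :=
  [/\ E `<=` P, convex_set E &
      forall (a : {i01 R}) (x y : convex_lmodType 'M[R]_n), E x -> E y ->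
        f (x <| a |> y) = (f x : R^o) <| a |> f y].

Definition max_affine_domain (P : set 'M[R]_n) (f : 'M[R]_n -> R)
    (E : set 'M[R]_n) :=
  affine_domain P f E /\
  forall E', affine_domain P f E' -> E `<=` E' -> E' = E.

Definition piecewise_affine (P : set 'M[R]_n) (f : 'M[R]_n -> R) :=
  exists L : set (set 'M[R]_n),
    [/\ finite_set L, forall E, L E -> closed E /\ affine_domain P f E &
        P = \bigcup_(E in L) E].

Definition regular_triangulation H T (K : set (set 'M[R]_n)) :=
  triangulation T K /\
  exists f : 'M[R]_n -> R,
    [/\ {within T `&` H, continuous f}, convex_function (T `&` H) f,
        piecewise_affine (T `&` H) f &
        forall E, max_affine_domain (T `&` H) f E <->
          exists2 s, K s & E = s `&` H].

Definition slice H :=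
  affine_subspace (dnum n).-1 H /\
  forall A, Cstar A -> A <> 0 ->
    exists! B, H B /\ exists2 a : R, 0 < a & B = a *: A.

(* The basis b of Y represents the orientation of Y. *)
Definition oriented (b : (dnum n).-tuple 'M[R]_n) (v : symbol n (dnum n)) :=
  0 < \det (\matrix_(i, j) coord b j (sq (val (v i)))).

(* x is [s]: every admissible listing of the vertices of s is allowed. *)
Definition is_sharbly_of (b : (dnum n).-tuple 'M[R]_n) (s : set 'M[R]_n)
    (x : sharbly n (dnum n)) :=
  exists v : symbol n (dnum n),
    [/\ simplicial_cone s v, oriented b v & x = basic v].

Definition flipon (x : sharbly n (dnum n)) :=
  exists2 v : symbol n (dnum n), x = basic v &
    exists2 E, affine_subspace (dnum n - 2) E &
      forall i, E (sq (val (v i))).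

Definition tile_representatives (D : set (SL n)) (RD : set (set 'M[R]_n)) :=
  RD `<=` tile /\
  forall T, tile T ->
    exists! T', RD T' /\ exists2 g, D g & T' = [set SL_act g A | A in T].

(* z is a cycle z_D: K T is the chosen triangulation of T, c s = [s], and fl
   lists the flipons. The set S is finite when D has finite index in SL_n(Z),
   as there are then finitely many D-orbits of tiles. *)
Definition is_zD (b : (dnum n).-tuple 'M[R]_n) H (D : set (SL n))
    (z : coinv (dnum n) D) :=
  exists (RD : set (set 'M[R]_n)) (K : set 'M[R]_n -> set (set 'M[R]_n))
         (c : set 'M[R]_n -> sharbly n (dnum n))
         (fl : seq (sharbly n (dnum n))),
    let S := \bigcup_(T in RD) K T in
    [/\ tile_representatives D RD,
        forall T, RD T -> regular_triangulation H T (K T),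
        (forall s, S s -> is_sharbly_of b s (c s)) /\
        (forall x, x \in fl -> flipon x),
        z = \sum_(s \in S) coproj D (c s) + \sum_(x <- fl) coproj D x &
        cobound z = 0].

End Voronoi.

(* Main.v *)
Require Import Defs.
From mathcomp Require Import all_boot all_order all_algebra finmap.
From mathcomp Require Import all_classical all_reals.

Import GRing.Theory.
Local Open Scope classical_set_scope.
Local Open Scope ring_scope.

(** Being a cycle passes from the smaller group to the larger one because iota
    is a chain map: the boundaries on the coinvariants of D and of G are both
    induced by one boundary on sharblies ([cobound_iota_map]).  Since [is_zD]
    asks for a cycle, the boundary of iota zD is the image of zero, and
    dividing by the index keeps it zero by linearity. *)

Lemma iota_map0 n m (D G : set (SL n)) :
  D `<=` G -> iota_map G (0 : coinv m D) = 0.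
Proof.
move=> DG; have -> : (0 : coinv m D) = coproj D 0.
  by rewrite /coproj raddf0.
by rewrite iota_mapE // /coproj raddf0.
Qed.

Lemma cobound_iota_map n m (D G : set (SL n)) (z : coinv m D) :
  D `<=` G -> cobound (iota_map G z) = iota_map G (cobound z).
Proof.
move=> DG; have -> : z = coproj D (repr z) by rewrite /coproj lprojP.
by rewrite iota_mapE // !coboundE iota_mapE.
Qed.

Theorem theorem5p3 (R : realType) (n : nat) (hn : (2 <= n)%N)
  (b : (dnum n).-tuple 'M[R]_n) (hb : basis_of (symY R n) b)
  (H : set 'M[R]_n) (hH : slice H)
  (G : set (SL n)) (hG : group_closed [in G]) (hGfin : finite_index setT G)
  (D : set (SL n)) (hD : group_closed [in D]) (hDG : normal_in G D)
  (hDfin : finite_index G D) (hDtf : torsionfree D)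
  (zD : coinv (dnum n) D) (hzD : is_zD b H zD) :
  let zG : coinv (dnum n) G := (group_index G D)%:R^-1 *: iota_map G zD in
  cobound zG = 0.
Proof.
move=> zG; have [DG _] := hDG.
have zD_cycle : cobound zD = 0 by case: hzD => [? [? [? [? []]]]].
by rewrite /zG linearZ /= cobound_iota_map // zD_cycle iota_map0 // scaler0.
Qed.
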